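(* Let $n,p\ge 1$ be integers, $\mathbf{X}\in\mathbb{R}^{n\times p}$ a deterministic matrix with columns $\boldsymbol{x}^1,\dots,\boldsymbol{x}^p$ satisfying $\max_{j\in[p]}\frac1n\|\boldsymbol{x}^j\|_2^2\le 1$, let $\boldsymbol{\beta}^\star\in\mathbb{R}^p$, and let $\boldsymbol{y}=\mathbf{X}\boldsymbol{\beta}^\star+\boldsymbol{\xi}$, where $\boldsymbol{\xi}$ is drawn from the Gaussian distribution $\mathcal{N}(0,\sigma^2\mathbf{I}_n)$ with $\sigma>0$. Let $\tau>0$, $\delta\in(0,1)$ and suppose $\lambda\ge 2\sigma\big(\frac{2}{n}\log(p/\delta)\big)^{1/2}$. Then, with probability at least $1-\delta$, the exponentially weighted aggregate $\widehat{\boldsymbol\beta}^{\rm EWA}$ with the Laplace prior satisfies $$\ell_n(\widehat{\boldsymbol\beta}^{\rm EWA},\boldsymbol\beta^\star)\le \inf_{\substack{\bar{\boldsymbol\beta}\in\mathbb{R}^p\\ J\subset[p]}}\Big\{\ell_n(\bar{\boldsymbol\beta},\boldsymbol\beta^\star)+4\lambda\|\bar{\boldsymbol\beta}_{J^c}\|_1+\frac{9\lambda^2|J|}{4\kappa_{J,3}}\Big\}+2p\tau .$$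
   Context: Notation: $[p]=\{1,\dots,p\}$; for $J\subset[p]$, $J^c=[p]\setminus J$, $|J|$ is the cardinality of $J$, and $\boldsymbol u_J$ is the subvector of $\boldsymbol u$ with coordinates in $J$. $\boldsymbol{x}_1,\dots,\boldsymbol{x}_n\in\mathbb{R}^p$ are the rows of $\mathbf{X}$. Prediction loss: $\ell_n(\boldsymbol\beta,\boldsymbol\beta')=\frac1n\|\mathbf{X}(\boldsymbol\beta-\boldsymbol\beta')\|_2^2$. For $\lambda>0$ and temperature $\tau>0$, the potential is $V_n(\boldsymbol\beta)=\frac{1}{2n}\sum_{i=1}^n(y_i-\boldsymbol{x}_i^\top\boldsymbol\beta)^2+\lambda\|\boldsymbol\beta\|_1$; the pseudo-posterior is the probability density on $\mathbb{R}^p$ with $\hat\pi_n(\boldsymbol\beta)\propto\exp(-V_n(\boldsymbol\beta)/\tau)$; and $\widehat{\boldsymbol\beta}^{\rm EWA}=\int_{\mathbb{R}^p}\boldsymbol\beta\,\hat\pi_n(\boldsymbol\beta)\,d\boldsymbol\beta$. Compatibility factor: for $J\subset[p]$ and $c>0$, $$\kappa_{J,c}=\inf_{\boldsymbol u\in\mathbb{R}^p:\ \|\boldsymbol u_{J^c}\|_1<c\|\boldsymbol u_J\|_1}\frac{c^2|J|\,\|\mathbf{X}\boldsymbol u\|_2^2}{n(c\|\boldsymbol u_J\|_1-\|\boldsymbol u_{J^c}\|_1)^2}.$$ Conventions: the term $|J|/\kappa_{J,c}$ equals $0$ for $J=\varnothing$ (the infimum over the empty set being $+\infty$) and equals $+\infty$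 if $J\ne\varnothing$ and $\kappa_{J,c}=0$. *)

(* Defs.v *)
From HB Require Import structures.
From mathcomp Require Import all_boot all_order all_algebra.
From mathcomp Require Import all_classical all_reals all_analysis.

Set Implicit Arguments.
Unset Strict Implicit.
Unset Printing Implicit Defensive.

Import Order.TTheory GRing.Theory Num.Theory.
Import numFieldNormedType.Exports.

Local Open Scope classical_set_scope.
Local Open Scope ring_scope.

Section power_measure.
Context d (T : measurableType d) (R : realType).

Definition tuple_cons n (z : T * n.-tuple T) : n.+1.-tuple T :=
  [tuple of z.1 :: z.2].

Lemma measurable_tuple_cons n : measurable_fun setT (@tuple_cons n).
Proof.
exact: (@measurable_cons _ _ _ _ fst n snd measurable_fst measurable_snd).
Qed.

Lemma tuple_cons_inj n : injective (@tuple_cons n).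
Proof. by move=> [x s] [y t] /(congr1 val)/= [-> /val_inj ->]. Qed.

Definition cons_measure (mu : set T -> \bar R) n
    (nu : set (n.-tuple T) -> \bar R) : set (n.+1.-tuple T) -> \bar R :=
  pushforward (mu \x nu)%E (@tuple_cons n).

Section cons_measure_instances.
Variables (mu : {sigma_finite_measure set T -> \bar R}) (n : nat).
Variable nu : {sigma_finite_measure set (n.-tuple T) -> \bar R}.
Let m := cons_measure mu nu.

Let m0 : m set0 = 0%E.
Proof. by rewrite /m /cons_measure /pushforward preimage_set0 measure0. Qed.

Let m_ge0 A : (0 <= m A)%E.
Proof. by rewrite /m /cons_measure /pushforward. Qed.

Let m_semi_sigma_additive : semi_sigma_additive m.
Proof.
have mc := @measurable_tuple_cons n; exact: measure_semi_sigma_additive.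
Qed.

HB.instance Definition _ := isMeasure.Build _ _ _ (cons_measure mu nu)
  m0 m_ge0 m_semi_sigma_additive.

Let m_sigma_finite : sigma_finite setT m.
Proof.
have /sigma_finiteP[F [TF ndF Foo]] := sigma_finiteT mu.
have /sigma_finiteP[G [TG ndG Goo]] := sigma_finiteT nu.
pose un (t : n.+1.-tuple T) : (T * n.-tuple T)%type :=
  (thead t, [tuple of behead t]).
have unK z : un (tuple_cons z) = z.
  by apply: tuple_cons_inj; rewrite /un /tuple_cons/= -tuple_eta.
have mun : measurable_fun setT un.
  apply: measurable_fun_pair; last exact: measurable_behead.
  exact: (measurable_tnth ord0).
exists (fun i => un @^-1` (F i `*` G i)).
  rewrite -preimage_bigcup (_ : \bigcup_i _ = setT) ?preimage_setT//.
  rewrite -setXTT TF TG predeqE => -[x y]; split.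
    by move=> [i _ []/= ? ?]; split; exists i.
  move=> [/= [i _ Fix] [k _ Gky]]; exists (maxn i k) => //; split.
    by move: x Fix; exact/subsetPset/ndF/leq_maxl.
  by move: y Gky; exact/subsetPset/ndG/leq_maxr.
move=> i; have [mF Flty] := Foo i; have [mG Glty] := Goo i; split.
  by rewrite -[X in measurable X]setTI; apply: mun => //; exact: measurableX.
rewrite /m /cons_measure /pushforward (_ : _ @^-1` _ = F i `*` G i).
  by rewrite product_measure1E// lte_mul_pinfty// ge0_fin_numE.
by apply/funext => z; rewrite /preimage /mkset unK.
Qed.

HB.instance Definition _ := Measure_isSigmaFinite.Build _ _ _
  (cons_measure mu nu) m_sigma_finite.

End cons_measure_instances.

(* The n-fold product measure mu \x ... \x mu, carried by n.-tuple T. *)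
Fixpoint power_measure (mu : set T -> \bar R) n : set (n.-tuple T) -> \bar R :=
  match n with
  | 0 => \d_ ([tuple] : 0.-tuple T)
  | m.+1 => cons_measure mu (@power_measure mu m)
  end.
Arguments power_measure : clear implicits.

Section instances.
Variable mu : {sigma_finite_measure set T -> \bar R}.

Lemma power_measureP n :
  exists nu : {sigma_finite_measure set (n.-tuple T) -> \bar R},
    nu = power_measure mu n :> (set (n.-tuple T) -> \bar R).
Proof.
elim: n => [|n [nu nuE]]; first by exists (\d_ ([tuple] : 0.-tuple T)).
by exists (cons_measure mu nu); rewrite /= -nuE.
Qed.

Variable n : nat.

Let power_measure0 : power_measure mu n set0 = 0%E.
Proof. by have [nu <-] := power_measureP n. Qed.

Let power_measure_ge0 A : (0 <= power_measure mu n A)%E.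
Proof. by have [nu <-] := power_measureP n. Qed.

Let power_measure_semi_sigma_additive :
  semi_sigma_additive (power_measure mu n).
Proof.
by have [nu <-] := power_measureP n; exact: measure_semi_sigma_additive.
Qed.

HB.instance Definition _ := isMeasure.Build _ _ _ (power_measure mu n)
  power_measure0 power_measure_ge0 power_measure_semi_sigma_additive.

Let power_measure_sigma_finite : sigma_finite setT (power_measure mu n).
Proof. by have [nu <-] := power_measureP n; exact: sigma_finiteT. Qed.

HB.instance Definition _ := Measure_isSigmaFinite.Build _ _ _
  (power_measure mu n) power_measure_sigma_finite.

End instances.
End power_measure.
Arguments power_measure {d T R} mu n.

(* On boxes, the power measure is the product of the masses of the sides;
   as mu is sigma-finite, this characterizes it. *)
Lemma power_measure_box d (T : measurableType d) (R : realType)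
    (mu : {sigma_finite_measure set T -> \bar R}) n (A : 'I_n -> set T) :
  (forall i, measurable (A i)) ->
  power_measure mu n [set t | forall i, A i (tnth t i)] =
  (\prod_(i < n) mu (A i))%E.
Proof.
elim: n A => [|n IH] A mA.
  by rewrite big_ord0 /= diracE mem_set// => -[].
rewrite big_ord_recl /= /cons_measure /pushforward -IH//.
rewrite -product_measure1E//; last first.
  rewrite (_ : mkset _ = \bigcap_(i in [set: 'I_n])
      ((fun t => tnth t i) @^-1` A (lift ord0 i))).
    apply: fin_bigcap_measurable => // i _.
    by rewrite -[X in measurable X]setTI; exact: measurable_tnth.
  by apply/seteqP; split => t /= h i; [move=> _|]; exact: h.
congr product_measure1; apply/seteqP; split => -[x t] /=.
  move=> h; split => [|i]; first exact: (h ord0).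
  by have := h (lift ord0 i); rewrite tnthS.
move=> [h0 h] i; have [j ->|->] := unliftP ord0 i; last exact: h0.
by rewrite tnthS; exact: h.
Qed.

Section exponentially_weighted_aggregate.
Context {R : realType}.
Implicit Types n p : nat.

Definition lebesgue_tuple p : set (p.-tuple (measurableTypeR R)) -> \bar R :=
  power_measure lebesgue_measure p.
Arguments lebesgue_tuple : clear implicits.

(* The law N(0, sigma^2 I_n): product of n copies of N(0, sigma^2), sigma being
   the standard deviation. *)
Definition isotropic_gaussian n (sigma : R) : set (n.-tuple R) -> \bar R :=
  power_measure (normal_prob 0 sigma) n.

Definition cvec n (t : n.-tuple R) : 'cV[R]_n := \col_i tnth t i.

Definition sqnorm2 n (u : 'cV[R]_n) : R := \sum_i u i 0 ^+ 2.

(* The l1-norm of the subvector u_J. *)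
Definition norm1 p (J : {set 'I_p}) (u : 'cV[R]_p) : R :=
  \sum_(j in J) `|u j 0|.

Definition pred_loss n p (X : 'M[R]_(n, p)) (b b' : 'cV[R]_p) : R :=
  n%:R^-1 * sqnorm2 (X *m (b - b')).

Definition potential n p (X : 'M[R]_(n, p)) (y : 'cV[R]_n) (lambda : R)
    (b : 'cV[R]_p) : R :=
  (2 * n%:R)^-1 * \sum_i (y i 0 - (row i X *m b) 0 0) ^+ 2
  + lambda * norm1 [set: 'I_p]%SET b.

Definition pseudo_posterior n p (X : 'M[R]_(n, p)) (y : 'cV[R]_n)
    (lambda tau : R) (b : 'cV[R]_p) : R :=
  let w b := expR (- potential X y lambda b / tau) in
  w b / \int[lebesgue_tuple p]_t w (cvec t).

Definition ewa n p (X : 'M[R]_(n, p)) (y : 'cV[R]_n) (lambda tau : R) :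
    'cV[R]_p :=
  \col_j \int[lebesgue_tuple p]_t
    (cvec t j 0 * pseudo_posterior X y lambda tau (cvec t)).

(* Equal to +oo when J is empty, the set of admissible u being empty. *)
Definition compatibility n p (X : 'M[R]_(n, p)) (J : {set 'I_p}) (c : R) :
    \bar R :=
  ereal_inf [set (c ^+ 2 * #|J|%:R * sqnorm2 (X *m u)
                  / (n%:R * (c * norm1 J u - norm1 (~: J) u) ^+ 2))%:E
            | u in [set u : 'cV[R]_p | norm1 (~: J) u < c * norm1 J u]].

End exponentially_weighted_aggregate.
Arguments lebesgue_tuple {R} p.

(* Main.v *)
(* Write V for the potential, q(u) = |X(u - b)|^2 / 2n, and m for the EWA, which is
   the mean of the density proportional to w = exp(-V/tau). The dilation of ratio
   0 < s < 1 centred at b multiplies the Lebesgue measure by s^p, and convexity of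
   V bounds V(b + s(u - b)) by V(u) - (1 - s)(V(u) + s q(u) - V(b)), where
   V + s q lies above its tangent at m. As 1 + x <= exp x and the linear part has
   mean 0 under w, integrating gives s^p (V(m) + s q(m) - V(b)) <= p tau, and
   s -> 1 yields V(m) + q(m) <= V(b) + p tau.

   When |X^T xi|_oo <= n lambda / 2, this implies the oracle inequality by the
   usual argument for the Lasso. That event has probability at least 1 - delta by
   a union bound, the two-sided Gaussian tail exp(-u^2/2v) being obtained, without
   a factor 2, by translating the Gaussian measure. As P is only monotone on
   measurable sets, the EWA also has to be a measurable function of the noise,
   which is an instance of Tonelli's theorem. *)

Require Import Defs.
From HB Require Import structures.
From mathcomp Require Import all_boot all_order all_algebra.
From mathcomp Require Import all_classical all_reals all_analysis.
From mathcomp Require Import measurable_realfun ring lra.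

Set Implicit Arguments.
Unset Strict Implicit.
Unset Printing Implicit Defensive.

Import Order.TTheory GRing.Theory Num.Theory.
Import numFieldNormedType.Exports.

Local Open Scope classical_set_scope.
Local Open Scope ring_scope.

(** * Integration against power measures *)

Section power_measure_integral.
Context d (T : measurableType d) (R : realType).
Variable mu : {sigma_finite_measure set T -> \bar R}.
Local Open Scope ereal_scope.

(** Tonelli on the first coordinate: the induction step for the integrals over tuples below. *)
Lemma ge0_integral_power_measureS n (f : n.+1.-tuple T -> \bar R) :
  measurable_fun setT f -> (forall t, 0 <= f t) ->
  \int[power_measure mu n.+1]_t f t =
  \int[mu]_x \int[power_measure mu n]_t f (tuple_cons (x, t)).
Proof.
move=> mf f0.
transitivity (\int[mu \x power_measure mu n]_z f (tuple_cons z)).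
  have -> : \int[power_measure mu n.+1]_t f t =
      \int[pushforward (mu \x power_measure mu n) (@tuple_cons _ T n)]_t f t.
    by [].
  rewrite (ge0_integral_pushforward (@measurable_tuple_cons _ T n))//.
by rewrite fubini_tonelli1//; apply: measurableT_comp => //;
  exact: measurable_tuple_cons.
Qed.

Lemma measurable_cons_r n (x : T) :
  measurable_fun setT (fun t : n.-tuple T => tuple_cons (x, t)).
Proof. exact: (measurableT_comp (@measurable_tuple_cons _ T n)). Qed.

Lemma measurable_power_measure_section d' (S : measurableType d') n
    (f : S * n.-tuple T -> \bar R) :
  measurable_fun setT f -> (forall z, 0 <= f z) ->
  measurable_fun setT (fun x => \int[power_measure mu n]_t f (x, t)).
Proof.
move=> mf f0; exact: measurable_fun_fubini_tonelli_F.
Qed.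

End power_measure_integral.

Lemma measurable_tuple_map d d' (T : measurableType d) (U : measurableType d') n
    (f : 'I_n -> T -> U) : (forall i, measurable_fun setT (f i)) ->
  measurable_fun setT
    (fun t : n.-tuple T => [tuple f i (tnth t i) | i < n] : n.-tuple U).
Proof.
move=> mf; apply/measurable_fun_tnthP => i.
rewrite [X in measurable_fun _ X](_ : _ = f i \o @tnth _ _ ^~ i).
  by apply: measurableT_comp => //; exact: measurable_tnth.
by apply/funext => t /=; rewrite tnth_mktuple.
Qed.

(** * Affine changes of variables for the Lebesgue measure *)

Section lebesgue_affine.
Variable R : realType.
Local Open Scope ereal_scope.
Local Notation mu := (@lebesgue_measure R).
Implicit Types b c s x : R.

Lemma ge0_integral_lebesgue_affine b s (f : measurableTypeR R -> \bar R) :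
  (0 < s)%R -> measurable_fun setT f -> (forall x, 0 <= f x) ->
  \int[mu]_x f (b + s * x)%R = (s^-1)%:E * \int[mu]_x f x.
Proof.
move=> s0 mf f0.
have s0' : (0 <= s)%R by exact: ltW.
pose phi : measurableTypeR R -> measurableTypeR R := fun x => (b + s * x)%R.
have mphi : measurable_fun setT phi.
  by apply: measurable_funD => //; exact: measurable_funM.
have [nu nuE] : exists nu : {measure set (measurableTypeR R) -> \bar R},
    nu = pushforward mu phi :> (set _ -> \bar R).
  by eexists (pushforward mu phi).
have muphi A : measurable A -> mu A = mscale (NngNum s0') nu A.
  apply: lebesgue_measure_unique => _ [[x y] /= xy <-].
  have phiI : phi @^-1` [set` `]x, y]%R] =
      [set` `]((x - b) / s)%R, ((y - b) / s)%R]%R].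
    apply/seteqP; split => z; rewrite /phi/= !in_itv/=.
      by rewrite ltr_pdivrMr// ler_pdivlMr// ltrBlDl lerBrDl mulrC.
    by rewrite ltr_pdivrMr// ler_pdivlMr// ltrBlDl lerBrDl mulrC.
  rewrite /mscale nuE.
  suff : mu [set` `]x, y]%R] = s%:E * mu (phi @^-1` [set` `]x, y]%R]) by [].
  rewrite phiI !lebesgue_measure_itv/= !lte_fin ltr_pM2r ?invr_gt0// ltrD2r.
  case: ifP => _; last by rewrite mule0.
  by rewrite -!EFinB -EFinM -mulrBl mulrC divfK ?gt_eqF//; congr EFin; ring.
have -> : \int[mu]_x f x = \int[mscale (NngNum s0') nu]_x f x.
  by apply: eq_measure_integral => A mA _; exact: muphi.
rewrite ge0_integral_mscale//= muleA -EFinM mulVf ?gt_eqF// mul1e nuE.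
by rewrite (ge0_integral_pushforward mphi).
Unshelve. all: exact: mphi. Qed.

(** Induction on [n], each coordinate contributing a factor [s^-1]. The offset varies with the
    coordinate so as to cover dilations centred at an arbitrary point. *)
Lemma ge0_integral_lebesgue_tuple_affine n (b : 'I_n -> R) s
    (f : n.-tuple (measurableTypeR R) -> \bar R) : (0 < s)%R ->
  measurable_fun setT f -> (forall t, 0 <= f t) ->
  \int[power_measure mu n]_t f [tuple (b i + s * tnth t i)%R | i < n] =
  ((s ^- n)%:E) * \int[power_measure mu n]_t f t.
Proof.
move=> s0; elim: n b f => [|n IH] b f mf f0.
  rewrite expr0 invr1 mul1e; apply: eq_integral => t _.
  by congr f; apply: eq_from_tnth => -[].
have maff : measurable_fun setT
    (fun t : n.+1.-tuple (measurableTypeR R) =>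
      [tuple (b i + s * tnth t i)%R | i < n.+1]
        : n.+1.-tuple (measurableTypeR R)).
  apply: (@measurable_tuple_map _ _ (measurableTypeR R) (measurableTypeR R) _
    (fun i x => b i + s * x)%R) => i.
  by apply: (@measurable_funD _ _ R) => //; exact: (@measurable_funM _ _ R).
rewrite ge0_integral_power_measureS//; last exact: measurableT_comp maff.
have consE x (t : n.-tuple (measurableTypeR R)) :
    [tuple (b i + s * tnth (tuple_cons (x, t)) i)%R | i < n.+1] =
    tuple_cons ((b ord0 + s * x)%R,
      [tuple (b (lift ord0 i) + s * tnth t i)%R | i < n]).
  apply: eq_from_tnth => i; rewrite tnth_mktuple.
  have [j ->|->] := unliftP ord0 i; last by rewrite !tnth0.
  by rewrite !tnthS tnth_mktuple.
pose F : measurableTypeR R -> \bar R :=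
  fun x => \int[power_measure mu n]_t f (tuple_cons (x, t)).
have mF : measurable_fun setT F.
  apply: (@measurable_power_measure_section _ _ _ mu _ _ n
    (f \o @tuple_cons _ _ _)); last by move=> z; exact: f0.
  by apply: measurableT_comp => //; exact: measurable_tuple_cons.
have F0 x : 0 <= F x by exact: integral_ge0.
transitivity (\int[mu]_x ((s ^- n)%:E * F (b ord0 + s * x)%R)).
  apply: eq_integral => x _.
  under eq_integral do rewrite consE.
  rewrite (IH _ (fun t => f (tuple_cons (_, t))))//.
  by apply: measurableT_comp => //; exact: measurable_cons_r.
rewrite ge0_integralZl//; last first.
- by rewrite lee_fin invr_ge0 exprn_ge0// ltW.
- apply: (measurableT_comp mF) => //.
  apply: (@measurable_funD _ _ R) => //; exact: (@measurable_funM _ _ R).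
rewrite (ge0_integral_lebesgue_affine _ s0 mF)//.
rewrite muleA -EFinM -invfM -exprSr.
by rewrite (ge0_integral_power_measureS mu mf).
Qed.

End lebesgue_affine.

(** * Translation of the Gaussian measure *)

Section gaussian_shift.
Variable R : realType.
Local Open Scope ereal_scope.
Local Notation mu := (@lebesgue_measure R).

(** The Radon-Nikodym derivative of the law and [normal_pdf] have the same integral over every
    measurable set, hence agree almost everywhere. *)
Lemma ge0_integral_normal_prob (m s : R) (f : measurableTypeR R -> \bar R) :
  measurable_fun setT f -> (forall x, 0 <= f x) ->
  \int[normal_prob m s]_x f x = \int[mu]_x (f x * (normal_pdf m s x)%:E).
Proof.
move=> mf f0.
have dom := normal_prob_dominates m s.
rewrite -(Radon_Nikodym_SigmaFinite.change_of_variables dom f0 measurableT mf).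
have mpdf : measurable_fun setT (EFin \o normal_pdf m s).
  by apply/measurable_EFinP; exact: measurable_normal_pdf.
have iRN := Radon_Nikodym_SigmaFinite.f_integrable dom.
have mRN := measurable_int _ iRN.
apply: ae_eq_integral => //.
- exact: emeasurable_funM.
- exact: emeasurable_funM.
- suff : ae_eq mu setT (Radon_Nikodym_SigmaFinite.f (normal_prob m s) mu)
      (EFin \o normal_pdf m s).
    by apply: filterS => x /= /[apply] ->.
  apply: integral_ae_eq => // A _ mA.
  by rewrite -Radon_Nikodym_SigmaFinite.f_integral.
Qed.

(** One-dimensional Cameron-Martin formula: the exponential factor is the ratio of [normal_pdf 0 s]
    at [x + h] to its value at [x]. *)
Lemma ge0_integral_normal_prob_shift (s h : R) (f : measurableTypeR R -> \bar R) :
  s != 0%R -> measurable_fun setT f -> (forall x, 0 <= f x) ->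
  \int[normal_prob 0 s]_x
    (f (x + h)%R * (expR (- (2 * h * x + h ^+ 2) / (2 * s ^+ 2)))%:E) =
  \int[normal_prob 0 s]_x f x.
Proof.
move=> s0 mf f0.
have mpdf : measurable_fun setT (EFin \o normal_pdf 0 s).
  by apply/measurable_EFinP; exact: measurable_normal_pdf.
have mfh : measurable_fun setT (fun x : measurableTypeR R => f (x + h)%R).
  by apply: (measurableT_comp mf) => //; exact: measurable_funD.
have mexp : measurable_fun setT (fun x : measurableTypeR R =>
    (expR (- (2 * h * x + h ^+ 2) / (2 * s ^+ 2)))%:E).
  apply/measurable_EFinP/measurableT_comp => //.
  by apply: measurable_funM => //; apply: measurableT_comp => //;
    apply: measurable_funD => //; exact: measurable_funM.
rewrite ge0_integral_normal_prob; last 2 first.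
- exact: emeasurable_funM.
- by move=> x; rewrite mule_ge0// lee_fin expR_ge0.
rewrite ge0_integral_normal_prob//.
(* A translation is the affine map of ratio 1. *)
have := @ge0_integral_lebesgue_affine R h 1 (fun x => f x * (normal_pdf 0 s x)%:E)
  ltr01.
rewrite invr1 mul1e => <-; last 2 first.
- exact: emeasurable_funM.
- by move=> x; rewrite mule_ge0// lee_fin normal_pdf_ge0.
apply: eq_integral => x _; rewrite mul1r (addrC h x) -muleA -EFinM.
congr (_ * _%:E); rewrite !normal_pdfE// mulrCA; congr (_ * _)%R.
rewrite /normal_fun -expRD; congr expR.
by rewrite -[(s ^+ 2 *+ 2)%R]mulr_natl; field.
Qed.

Lemma measurable_tuple_shift n (h : 'I_n -> R) : measurable_fun setT
  (fun t : n.-tuple (measurableTypeR R) =>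
    [tuple (tnth t i + h i)%R | i < n] : n.-tuple (measurableTypeR R)).
Proof.
apply: (@measurable_tuple_map _ _ (measurableTypeR R) (measurableTypeR R) _
  (fun i x => x + h i)%R) => i.
exact: (@measurable_funD _ _ R).
Qed.

Lemma measurable_shift_weight n (s : R) (h : 'I_n -> R) : measurable_fun setT
  (fun t : n.-tuple (measurableTypeR R) =>
   (expR (- (\sum_(i < n) (2 * h i * tnth t i + h i ^+ 2)) / (2 * s ^+ 2)))%:E).
Proof.
apply/measurable_EFinP/measurableT_comp => //.
apply: (@measurable_funM _ _ R) => //; apply: (@measurableT_comp _ _ _ _ _ R) => //.
apply: measurable_sum => i; apply: (@measurable_funD _ _ R) => //.
by apply: (@measurable_funM _ _ R) => //; exact: measurable_tnth.
Qed.

(** The Cameron-Martin weight is a product over the coordinates, so they can be translated one after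
    the other. *)
Lemma ge0_integral_isotropic_gaussian_shift n (s : R) (h : 'I_n -> R)
    (f : n.-tuple (measurableTypeR R) -> \bar R) :
  s != 0%R -> measurable_fun setT f -> (forall t, 0 <= f t) ->
  \int[power_measure (normal_prob 0 s) n]_t
    (f [tuple (tnth t i + h i)%R | i < n] *
     (expR (- (\sum_(i < n) (2 * h i * tnth t i + h i ^+ 2)) / (2 * s ^+ 2)))%:E) =
  \int[power_measure (normal_prob 0 s) n]_t f t.
Proof.
move=> s0; elim: n h f => [|n IH] h f mf f0.
  apply: eq_integral => t _; rewrite big_ord0 oppr0 mul0r expR0 mule1.
  by congr f; apply: eq_from_tnth => -[].
rewrite ge0_integral_power_measureS; last 2 first.
- apply: emeasurable_funM; last exact: measurable_shift_weight.
  exact: (measurableT_comp mf (measurable_tuple_shift _)).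
- by move=> t; rewrite mule_ge0// lee_fin expR_ge0.
rewrite (ge0_integral_power_measureS _ mf f0).
have consE x (t : n.-tuple (measurableTypeR R)) :
    [tuple (tnth (tuple_cons (x, t)) i + h i)%R | i < n.+1] =
    tuple_cons ((x + h ord0)%R,
      [tuple (tnth t i + h (lift ord0 i))%R | i < n]).
  apply: eq_from_tnth => i; rewrite tnth_mktuple.
  have [j ->|->] := unliftP ord0 i; last by rewrite !tnth0.
  by rewrite !tnthS tnth_mktuple.
pose F : measurableTypeR R -> \bar R :=
  fun x => \int[power_measure (normal_prob 0 s) n]_t f (tuple_cons (x, t)).
have mF : measurable_fun setT F.
  apply: (@measurable_power_measure_section _ _ _ (normal_prob 0 s) _ _ n
    (f \o @tuple_cons _ _ _)); last by move=> z; exact: f0.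
  by apply: measurableT_comp => //; exact: measurable_tuple_cons.
have F0 x : 0 <= F x by exact: integral_ge0.
rewrite -[RHS](ge0_integral_normal_prob_shift (h ord0) s0 mF F0).
apply: eq_integral => x _.
rewrite /F -(IH (fun i => h (lift ord0 i)) (fun t => f (tuple_cons (_, t))))//;
  last by apply: measurableT_comp => //; exact: measurable_cons_r.
rewrite -ge0_integralZr//; last 2 first.
- apply: emeasurable_funM; last exact: measurable_shift_weight.
  apply: (measurableT_comp mf).
  exact: (measurableT_comp (measurable_cons_r (x + h ord0)%R)
    (measurable_tuple_shift _)).
- by move=> t _; rewrite mule_ge0// lee_fin expR_ge0.
apply: eq_integral => t _; rewrite consE -muleA -EFinM -expRD.
congr (_ * (expR _)%:E); rewrite big_ord_recl tnth0.
under eq_bigr do rewrite tnthS.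
by rewrite -mulrDl -opprD addrC.
Qed.

End gaussian_shift.

(** * Gaussian tails *)

Section gaussian_tail.
Variables (R : realType) (n : nat).
Local Open Scope ereal_scope.
Implicit Types (a : 'I_n -> R) (s u : R).

Lemma measurable_linear_form a :
  measurable_fun setT
    (fun t : n.-tuple (measurableTypeR R) => (\sum_i a i * tnth t i)%R).
Proof.
apply: measurable_sum => i; apply: (@measurable_funM _ _ R) => //.
exact: measurable_tnth.
Qed.

Lemma measurable_halfspace a u :
  measurable [set t : n.-tuple (measurableTypeR R) | (u < \sum_i a i * tnth t i)%R].
Proof.
rewrite -[X in measurable X]setTI.
rewrite (_ : [set t | _] = (fun t : n.-tuple (measurableTypeR R) =>
  (\sum_i a i * tnth t i)%R) @^-1` `]u, +oo[%classic); last first.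
  by apply/seteqP; split => t /=; rewrite in_itv/= andbT.
exact: measurable_linear_form.
Qed.

Lemma measurable_abs_linear_form_gt a u : measurable
  [set t : n.-tuple (measurableTypeR R) | (u < `|\sum_i a i * tnth t i|)%R].
Proof.
rewrite -[X in measurable X]setTI.
rewrite (_ : [set t | _] = (fun t : n.-tuple (measurableTypeR R) =>
  `|\sum_i a i * tnth t i|)%R @^-1` `]u, +oo[%classic); last first.
  by apply/seteqP; split => t /=; rewrite in_itv/= andbT.
have /= := measurableT_comp (@normr_measurable R setT) (measurable_linear_form a).
exact.
Qed.

(* Translation by [u / |a|^2 *: a] maps the half-space [a > 0] onto [a > u]. *)
Lemma isotropic_gaussian_halfspace s a u :
  (0 < s)%R -> (0 < u)%R -> (0 < \sum_i a i ^+ 2)%R ->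
  isotropic_gaussian s [set t : n.-tuple R | (u < \sum_i a i * tnth t i)%R] <=
  (expR (- u ^+ 2 / (2 * s ^+ 2 * \sum_i a i ^+ 2)))%:E *
  isotropic_gaussian s [set t : n.-tuple R | (0 < \sum_i a i * tnth t i)%R].
Proof.
move=> s0 u0; set A := (\sum_i a i ^+ 2)%R => A0.
have An0 : A != 0%R by rewrite gt_eqF.
have sn0 : s != 0%R by rewrite gt_eqF.
rewrite /isotropic_gaussian.
set g := power_measure _ _.
set H := fun v : R => [set t : n.-tuple (measurableTypeR R) |
  (v < \sum_i a i * tnth t i)%R].
have mH v : measurable (H v) by exact: measurable_halfspace.
have mI v : measurable_fun setT (fun t => (\1_(H v) t : R)%:E).
  by apply/measurable_EFinP; exact: measurable_indic.
rewrite -[X in X <= _](_ : \int[g]_t (\1_(H u) t)%:E = _); last first.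
  by rewrite integral_indic// setIT.
rewrite -[X in _ * X](_ : \int[g]_t (\1_(H 0%R) t)%:E = _); last first.
  by rewrite integral_indic// setIT.
rewrite -(ge0_integral_isotropic_gaussian_shift
  (fun i => u * a i / A)%R sn0 (mI u)); last by move=> t; rewrite lee_fin.
rewrite -ge0_integralZl//.
apply: ge0_le_integral => //.
- apply: emeasurable_funM; last exact: measurable_shift_weight.
  exact: (measurableT_comp (mI u) (measurable_tuple_shift _)).
- exact: emeasurable_funM.
move=> t _.
have E1 : (\sum_i a i * tnth [tuple tnth t i + u * a i / A | i < n] i =
    \sum_i a i * tnth t i + u)%R.
  under eq_bigr do rewrite tnth_mktuple mulrDr.
  rewrite big_split/=; congr (_ + _)%R.
  rewrite -[RHS](mulfK An0) -mulrA mulrCA mulr_suml.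
  by apply: eq_bigr => i _; ring.
have E2 : (\sum_i (2 * (u * a i / A) * tnth t i + (u * a i / A) ^+ 2) =
    2 * u / A * (\sum_i a i * tnth t i) + u ^+ 2 / A)%R.
  rewrite big_split/= mulr_sumr; congr (_ + _)%R.
    by apply: eq_bigr => i _; ring.
  transitivity ((u / A) ^+ 2 * A)%R; last by field.
  by rewrite mulr_sumr; apply: eq_bigr => i _; ring.
rewrite -EFinM lee_fin !indicE.
have -> : ([tuple (tnth t i + u * a i / A)%R | i < n] \in H u) = (t \in H 0%R).
  by apply/idP/idP => /set_mem/= tH; apply/mem_set; move: tH;
     rewrite /H /= E1; lra.
case: (boolP (t \in H 0%R)) => [/set_mem /= tH|_]; last by rewrite mul0r mulr0.
rewrite mul1r mulr1 ler_expR E2.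
(* The two exponents differ by a positive multiple of the linear form at [t], which is positive on
   the half-space. *)
rewrite -subr_ge0 [X in (0 <= X)%R](_ : _ =
  u * (\sum_i a i * tnth t i) / (A * s ^+ 2))%R; last by field; rewrite An0 sn0.
by rewrite divr_ge0// mulr_ge0 ?sqr_ge0// ltW.
Qed.


Lemma isotropic_gaussian_setT s : isotropic_gaussian s [set: n.-tuple R] = 1.
Proof.
rewrite /isotropic_gaussian -[X in power_measure _ _ X](_ :
  [set t | forall i, setT (tnth t i)] = _); last by apply/seteqP; split.
rewrite (@power_measure_box _ _ _ (normal_prob 0 s) _ (fun=> setT))//.
by rewrite big1// => i _; exact: probability_setT.
Qed.

(* There is no factor 2 because the two tails are compared with opposite open
   half-spaces, whose masses add up to at most 1. *)
Lemma isotropic_gaussian_tail s a (u v : R) : (0 < s)%R -> (0 < u)%R ->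
  (0 < v)%R -> (\sum_i a i ^+ 2 <= v)%R ->
  isotropic_gaussian s [set t : n.-tuple R | (u < `|\sum_i a i * tnth t i|)%R] <=
  (expR (- u ^+ 2 / (2 * s ^+ 2 * v)))%:E.
Proof.
move=> s0 u0 v0 av; set A := (\sum_i a i ^+ 2)%R in av.
have : (0 <= A)%R by apply: sumr_ge0 => i _; exact: sqr_ge0.
(* If [a] vanishes there is no direction to translate along, but the event is empty. *)
rewrite le_eqVlt => /predU1P[A0|A0].
  have a0 i : a i = 0%R.
    apply/eqP; rewrite -sqrf_eq0.
    have /eqP := esym A0; rewrite psumr_eq0; last by move=> j _; exact: sqr_ge0.
    by move=> /allP/(_ i (mem_index_enum _)).
  rewrite [X in isotropic_gaussian s X](_ : _ = set0).
    by rewrite /isotropic_gaussian measure0 lee_fin expR_ge0.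
  apply/seteqP; split => t //=; rewrite big1.
    by rewrite normr0 ltNge ltW.
  by move=> i _; rewrite a0 mul0r.
(* The bound increases with the variance, so it is enough to prove it with [A] in place of [v]. *)
apply: (@le_trans _ _ (expR (- u ^+ 2 / (2 * s ^+ 2 * A)))%:E); last first.
  rewrite lee_fin ler_expR !mulNr lerN2 ler_wpM2l ?sqr_ge0// lef_pV2 ?posrE.
  - by rewrite ler_wpM2l// mulr_ge0// sqr_ge0.
  - by rewrite !mulr_gt0// exprn_gt0.
  - by rewrite !mulr_gt0// exprn_gt0.
pose b i := (- a i)%R.
have bE t : (\sum_i b i * tnth t i = - \sum_i a i * tnth t i)%R.
  by rewrite -sumrN; apply: eq_bigr => i _; rewrite mulNr.
have bA : (\sum_i b i ^+ 2 = A)%R by apply: eq_bigr => i _; rewrite sqrrN.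
rewrite /isotropic_gaussian.
pose H (c : 'I_n -> R) w := [set t : n.-tuple (measurableTypeR R) |
  (w < \sum_i c i * tnth t i)%R].
have mH c w : measurable (H c w) by exact: measurable_halfspace.
have -> : [set t : n.-tuple R | (u < `|\sum_i a i * tnth t i|)%R] =
    H a u `|` H b u.
  apply/seteqP; split => t; rewrite /H/= bE ltr_normr; first by move=> /orP.
  by move=> ?; apply/orP.
have := measureU2 (power_measure (normal_prob 0 s) n) (mH a u) (mH b u).
move=> /le_trans; apply.
have Ha := isotropic_gaussian_halfspace s0 u0 A0.
have Hb : _ := @isotropic_gaussian_halfspace s b u s0 u0.
rewrite bA in Hb; have {}Hb := Hb A0.
apply: le_trans (leeD Ha Hb) _.
rewrite -ge0_muleDr//.
rewrite -[leRHS]mule1 lee_wpmul2l ?lee_fin ?expR_ge0//.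
rewrite -(isotropic_gaussian_setT s) /isotropic_gaussian.
rewrite -measureU//; last first.
  apply/seteqP; split => t //= []; rewrite bE; lra.
- exact: (mH b 0%R).
- exact: (mH a 0%R).
- apply: le_measure; rewrite ?inE//.
  by apply: measurableU; [exact: (mH a 0%R)|exact: (mH b 0%R)].
Qed.

End gaussian_tail.

(** * Means of log-concave densities *)

Section laplace_integral.
Variable R : realType.
Local Open Scope ereal_scope.
Local Notation mu := (@lebesgue_measure R).

(** By symmetry the integral is twice that over the half-line, where the integrand is [c^-1] times
    the exponential density. *)
Lemma integral_laplace_lty (c : R) : (0 < c)%R ->
  \int[mu]_x (expR (- (c * `|x|)))%:E < +oo.
Proof.
move=> c0.
have cf : continuous (fun x : R => expR (- (c * `|x|))).
  move=> x; apply: (@continuous_comp _ _ _ (fun x : R => - (c * `|x|))%R expR).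
    apply: cvgN; apply: cvgM; first exact: cvg_cst.
    exact: norm_continuous.
  exact: continuous_expR.
have mf : measurable_fun setT
    (fun x : measurableTypeR R => expR (- (c * `|x|))).
  exact: (continuous_measurable_fun cf).
rewrite (@ge0_symfun_integralT _ (fun x => expR (- (c * `|x|)))%R); last 3 first.
- by move=> x; rewrite expR_ge0.
- exact: cf.
- by move=> x /=; rewrite normrN.
apply: lte_mul_pinfty => //.
have mpdf : measurable_fun setT (fun x : measurableTypeR R =>
    (c^-1)%:E * (exponential_pdf c x)%:E).
  apply: emeasurable_funM => //.
  apply/measurable_EFinP; exact: measurable_exponential_pdf.
apply: (@le_lt_trans _ _ (\int[mu]_x ((c^-1)%:E * (exponential_pdf c x)%:E))).
  have mD : measurable [set x : measurableTypeR R | (0 <= x)%R].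
    by rewrite -set_itvcy; exact: measurable_itv.
  apply: (@le_trans _ _ (\int[mu]_(x in [set x : measurableTypeR R | (0 <= x)%R])
      ((c^-1)%:E * (exponential_pdf c x)%:E))).
    apply: ge0_le_integral => //.
    - apply: measurable_funTS; apply/measurable_EFinP; exact: mf.
    - exact: measurable_funTS.
    - move=> x x0; rewrite exponential_pdfE// ger0_norm// -EFinM lee_fin.
      by rewrite mulrA mulVf ?gt_eqF// mul1r mulNr.
  apply: ge0_subset_integral => // x _.
  by rewrite mule_ge0// lee_fin ?invr_ge0 ?exponential_pdf_ge0// ltW.
rewrite ge0_integralZl//.
- by rewrite integral_exponential_pdf// mule1 ltry.
- by apply/measurable_EFinP; exact: measurable_exponential_pdf.
- by move=> x _; rewrite lee_fin exponential_pdf_ge0// ltW.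
- by rewrite lee_fin invr_ge0 ltW.
Qed.

Lemma measurable_laplace n (c : R) : measurable_fun setT
  (fun t : n.-tuple (measurableTypeR R) => expR (- (c * \sum_i `|tnth t i|))).
Proof.
apply: measurableT_comp => //; apply: (@measurableT_comp _ _ _ _ _ R) => //.
apply: (@measurable_funM _ _ R) => //; apply: measurable_sum => i.
by apply: measurableT_comp => //; exact: measurable_tnth.
Qed.

(** The integrand is a product over the coordinates, so the integral over tuples factorizes. *)
Lemma integral_laplace_tuple_lty n (c : R) : (0 < c)%R ->
  \int[power_measure mu n]_t (expR (- (c * \sum_i `|tnth t i|)))%:E < +oo.
Proof.
move=> c0; elim: n => [|n IH].
  rewrite integral_dirac//= ?diracT ?mul1e ?ltry//.
  by apply/measurable_EFinP; exact: measurable_laplace.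
rewrite ge0_integral_power_measureS; last 2 first.
- by apply/measurable_EFinP; exact: measurable_laplace.
- by move=> t; rewrite lee_fin expR_ge0.
rewrite (_ : \int[_]_x _ =
    \int[mu]_x ((expR (- (c * `|x|)))%:E *
      \int[power_measure mu n]_t (expR (- (c * \sum_i `|tnth t i|)))%:E)).
  have I0 m : 0 <= \int[power_measure mu m]_t
      (expR (- (c * \sum_i `|tnth t i|)))%:E.
    by apply: integral_ge0 => x _; rewrite lee_fin expR_ge0.
  rewrite ge0_integralZr//.
  - apply: lte_mul_pinfty => //.
      by apply: integral_ge0 => x _; rewrite lee_fin expR_ge0.
    rewrite ge0_fin_numE; first exact: integral_laplace_lty.
    by apply: integral_ge0 => x _; rewrite lee_fin expR_ge0.
  - apply/measurable_EFinP/measurableT_comp => //.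
    apply: (@measurableT_comp _ _ _ _ _ R) => //.
    exact: (@measurable_funM _ _ R).
apply: eq_integral => x _; rewrite -ge0_integralZl//; last first.
  by apply/measurable_EFinP; exact: measurable_laplace.
apply: eq_integral => t _; rewrite -EFinM -expRD big_ord_recl tnth0.
under eq_bigr do rewrite tnthS.
by rewrite mulrDr opprD.
Qed.

End laplace_integral.

Section Rintegral_sum.
Context d (T : measurableType d) (R : realType) (I : finType).
Variables (mu : {measure set T -> \bar R}) (f : I -> T -> R).
Hypothesis fi : forall i, mu.-integrable setT (EFin \o f i).

Lemma integrable_EFin_sum :
  mu.-integrable setT (EFin \o (fun x => \sum_i f i x)).
Proof.
rewrite [X in integrable _ _ X](_ : _ = (fun x => \sum_i (EFin \o f i) x)%E).
  by apply: integrable_sum => // i _; exact: fi.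
by apply/funext => x /=; rewrite sumEFin.
Qed.

Lemma Rintegral_sum :
  \int[mu]_x (\sum_i f i x) = \sum_i \int[mu]_x f i x.
Proof.
rewrite /Rintegral; under eq_integral do rewrite -sumEFin.
rewrite (@integral_sum _ _ _ mu setT _ _ (fun i => EFin \o f i))//.
by rewrite sum_fine// => i _; have := integrable_fin_num measurableT (fi i).
Qed.

End Rintegral_sum.

Section gibbs_mean.
Variables (R : realType) (p : nat).
Local Notation T := (p.-tuple (measurableTypeR R)).
Local Notation leb := (power_measure (@lebesgue_measure R) p).
Variables (U : 'cV[R]_p -> R) (c C : R).
Hypothesis c_gt0 : 0 < c.
Hypothesis mU : measurable_fun setT (fun t : T => U (cvec t)).
Hypothesis U_ge : forall b, c * norm1 [set: 'I_p]%SET b - C <= U b.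

(** [U] plays the role of the potential divided by the temperature. Its linear lower bound dominates
    the weight by a Laplace density up to a constant, which makes the integrals below converge. *)
Definition gibbs_weight (b : 'cV[R]_p) : R := expR (- U b).
Definition gibbs_mass : R := \int[leb]_t gibbs_weight (cvec t).
Definition gibbs_mean : 'cV[R]_p :=
  \col_j (\int[leb]_t (tnth t j * gibbs_weight (cvec t)) / gibbs_mass).

Lemma measurable_gibbs_weight :
  measurable_fun setT (fun t : T => gibbs_weight (cvec t)).
Proof. by apply: measurableT_comp => //; exact: measurableT_comp. Qed.

Lemma norm1_cvec (t : T) :
  norm1 [set: 'I_p]%SET (cvec t) = \sum_i `|tnth t i|.
Proof.
by rewrite /norm1; apply: eq_big => i; rewrite ?inE// => _; rewrite mxE.
Qed.

Lemma integrable_laplace_tuple e (M : R) : 0 < e -> leb.-integrable setT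
  (EFin \o (fun t : T => M * expR (- (e * \sum_i `|tnth t i|)))).
Proof.
move=> e0; rewrite [X in integrable _ _ X](_ : _ =
  (fun t : T => M%:E * (expR (- (e * \sum_i `|tnth t i|)))%:E)%E); last first.
  by apply/funext => t /=; rewrite EFinM.
apply: integrableZl => //; apply/integrableP; split.
  by apply/measurable_EFinP; exact: measurable_laplace.
under eq_integral do rewrite gee0_abs ?lee_fin ?expR_ge0//.
exact: integral_laplace_tuple_lty.
Qed.

Lemma integrable_gibbs_weight :
  leb.-integrable setT (EFin \o (fun t : T => gibbs_weight (cvec t))).
Proof.
apply: le_integrable (integrable_laplace_tuple (expR C) c_gt0) => //.
  by apply/measurable_EFinP; exact: measurable_gibbs_weight.
move=> t _ /=; rewrite lee_fin !ger0_norm ?mulr_ge0 ?expR_ge0//.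
rewrite -expRD ler_expR -norm1_cvec.
by have := U_ge (cvec t); lra.
Qed.

(** Half of the exponential decay absorbs the coordinate: [x <= expR x] at [x = c / 2 * S] bounds
    [|t_j|] by [2 / c * expR (c / 2 * S)], and decay at rate [c / 2] is left. *)
Lemma integrable_gibbs_coord j : leb.-integrable setT
  (EFin \o (fun t : T => tnth t j * gibbs_weight (cvec t))).
Proof.
have c2 : 0 < c / 2 by rewrite divr_gt0.
apply: le_integrable (integrable_laplace_tuple (2 / c * expR C) c2) => //.
  apply/measurable_EFinP/measurable_funM; last exact: measurable_gibbs_weight.
  exact: measurable_tnth.
move=> t _ /=; rewrite lee_fin normrM.
rewrite [in leLHS](ger0_norm (expR_ge0 _)) [leRHS]ger0_norm; last first.
  by rewrite !mulr_ge0 ?expR_ge0// invr_ge0 ltW.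
set S := \sum_i _.
have tj : c / 2 * `|tnth t j| <= expR (c / 2 * S).
  apply: (@le_trans _ _ (c / 2 * S)); last first.
    by apply: le_trans (expR_ge1Dx _); rewrite lerDr.
  by rewrite ler_pM2l// /S (bigD1 j)//= lerDl sumr_ge0.
have wt : gibbs_weight (cvec t) <= expR C * expR (- (c * S)).
  rewrite -expRD ler_expR /S -norm1_cvec.
  by have := U_ge (cvec t); lra.
apply: (@le_trans _ _ (2 / c * expR (c / 2 * S) * (expR C * expR (- (c * S))))).
  apply: ler_pM => //.
  rewrite -(ler_pM2l c2) mulrA [c / 2 * (2 / c)](_ : _ = 1) ?mul1r//.
  by field; rewrite gt_eqF.
rewrite -!mulrA ler_pM2l// ler_pM2l ?invr_gt0// mulrCA ler_pM2l ?expR_gt0//.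
by rewrite -expRD ler_expR; lra.
Qed.

(** A positive function with zero integral would make the whole space a null set, whereas its
    Lebesgue mass is a product of nonzero factors. *)
Lemma gibbs_mass_gt0 : 0 < gibbs_mass.
Proof.
have w0 t : 0 <= gibbs_weight (cvec t) by exact: expR_ge0.
rewrite lt_neqAle Rintegral_ge0 ?andbT//; apply/negP => /eqP Z0.
have I0 : (\int[leb]_t `|(gibbs_weight (cvec t))%:E| = 0)%E.
  under eq_integral do rewrite gee0_abs ?lee_fin//.
  rewrite -[LHS]fineK; first by rewrite [fine _](esym Z0).
  exact: integrable_fin_num integrable_gibbs_weight.
have mw : measurable_fun setT (EFin \o (fun t : T => gibbs_weight (cvec t))).
  by apply/measurable_EFinP; exact: measurable_gibbs_weight.
have /(ae_eq_integral_abs _ measurableT mw)[N [mN N0 subN]] := I0.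
have : leb setT = 0%E.
  apply: subset_measure0 N0 => //.
  apply: subset_trans subN => t _ /= /(_ I)[]/eqP.
  by rewrite gt_eqF// expR_gt0.
rewrite [X in leb X](_ : _ =
  [set t : T | forall i, setT (tnth t i)]); last by apply/seteqP; split.
rewrite (@power_measure_box _ _ _ (@lebesgue_measure R) _ (fun=> setT))//.
apply/eqP; elim/big_ind : _ => // [x y x0 y0|i _].
  by rewrite mule_neq0.
suff : lebesgue_measure [set: R] != 0%E by [].
by rewrite -set_itvNyy lebesgue_measure_itv.
Qed.


End gibbs_mean.

Section gibbs_dilation.
Variables (R : realType) (p : nat).
Local Notation T := (p.-tuple (measurableTypeR R)).
Local Notation leb := (power_measure (@lebesgue_measure R) p).
Variables (U : 'cV[R]_p -> R) (c C : R).
Hypothesis c_gt0 : 0 < c.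
Hypothesis mU : measurable_fun setT (fun t : T => U (cvec t)).
Hypothesis U_ge : forall b, c * norm1 [set: 'I_p]%SET b - C <= U b.

Let iw := integrable_gibbs_weight c_gt0 mU U_ge.
Let iwj := integrable_gibbs_coord c_gt0 mU U_ge.
Let Z := gibbs_mass U.
Let Z_gt0 : 0 < Z := gibbs_mass_gt0 c_gt0 mU U_ge.
Let mw := measurable_gibbs_weight mU.

(** The dilation acts on coordinate [i] by [x |-> (1 - s) * b i 0 + s * x], so the affine change of
    variables applies. *)
Lemma gibbs_mass_dilation (b : 'cV[R]_p) s : 0 < s ->
  leb.-integrable setT
    (EFin \o (fun t : T => gibbs_weight U (b + s *: (cvec t - b)))) /\
  \int[leb]_t gibbs_weight U (b + s *: (cvec t - b)) = s ^- p * Z.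
Proof.
move=> s0.
have w0 u : (0 <= (gibbs_weight U u)%:E)%E by rewrite lee_fin expR_ge0.
have mEw : measurable_fun setT (EFin \o (fun t : T => gibbs_weight U (cvec t))).
  exact/measurable_EFinP.
pose h (i : 'I_p) (x : R) := (1 - s) * b i 0 + s * x.
have hE (t : T) : cvec [tuple h i (tnth t i) | i < p] = b + s *: (cvec t - b).
  apply/colP => i; rewrite !mxE tnth_mktuple /h; ring.
have mh : measurable_fun setT
    (fun t : T => [tuple h i (tnth t i) | i < p] : T).
  apply: (@measurable_tuple_map _ _ (measurableTypeR R) (measurableTypeR R) _ h).
  by move=> i; rewrite /h; apply: (@measurable_funD _ _ R) => //;
    exact: (@measurable_funM _ _ R).
have E : (\int[leb]_t (gibbs_weight U (b + s *: (cvec t - b)))%:E =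
    (s ^- p)%:E * \int[leb]_t (gibbs_weight U (cvec t))%:E)%E.
  rewrite -(@ge0_integral_lebesgue_tuple_affine _ _ (fun i => (1 - s) * b i 0) s
    (fun t => (gibbs_weight U (cvec t))%:E))//.
  by apply: eq_integral => t _; rewrite -hE.
split; last by rewrite /Rintegral E fineM//; exact: integrable_fin_num iw.
apply/integrableP; split.
  rewrite [X in measurable_fun _ X](_ : _ =
      (EFin \o (fun t : T => gibbs_weight U (cvec t))) \o
      (fun t : T => [tuple h i (tnth t i) | i < p])).
    exact: measurableT_comp mEw mh.
  by apply/funext => t /=; rewrite hE.
under eq_integral do rewrite /= ger0_norm ?expR_ge0//.
rewrite E; have := integrable_fin_num measurableT iw.
move=> /fineK <-; by rewrite -EFinM ltry.
Qed.

(** The linear part is centred at the mean of the normalized weight and integrates to 0; only the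
    constant [a] survives. *)
Lemma Rintegral_gibbs_affine (a : R) (g : 'I_p -> R) :
  let h t := gibbs_weight U (cvec t) *
    (a + \sum_j g j * (tnth t j - gibbs_mean U j 0)) in
  leb.-integrable setT (EFin \o h) /\ \int[leb]_t h t = a * Z.
Proof.
move=> h.
pose k0 (t : T) : R :=
  (a - \sum_j g j * gibbs_mean U j 0) * gibbs_weight U (cvec t).
pose k (j : 'I_p) (t : T) : R := g j * (tnth t j * gibbs_weight U (cvec t)).
have iZ (r : R) (f : T -> R) : leb.-integrable setT (EFin \o f) ->
    leb.-integrable setT (EFin \o (fun t => r * f t)).
  move=> If; rewrite [X in integrable _ _ X](_ : _ =
    (fun t : T => r%:E * (EFin \o f) t)%E); first exact: integrableZl.
  by apply/funext => t /=; rewrite EFinM.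
have ik0 : leb.-integrable setT (EFin \o k0) by exact/iZ/iw.
have ik j : leb.-integrable setT (EFin \o k j) by exact/iZ/iwj.
have iS := integrable_EFin_sum ik.
have hE : h = (fun t => k0 t + \sum_j k j t).
  apply/funext => t; rewrite /h /k0 /k mulrDr mulrBl mulrC -addrA; congr (_ + _).
  rewrite mulr_suml mulr_sumr -sumrN -big_split/=.
  by apply: eq_bigr => j _; ring.
rewrite hE; split.
  rewrite [X in integrable _ _ X](_ : _ =
    ((EFin \o k0) \+ (EFin \o (fun t => \sum_j k j t)%R))%E).
    exact: integrableD.
  by apply/funext => t /=; rewrite EFinD.
have I0 : \int[leb]_t k0 t = (a - \sum_j g j * gibbs_mean U j 0) * Z.
  exact: (RintegralZl _ measurableT iw).
have Ik j : \int[leb]_t k j t = g j * gibbs_mean U j 0 * Z.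
  rewrite [LHS](RintegralZl (g j) measurableT (iwj j)).
  by rewrite mxE -mulrA divfK// gt_eqF.
rewrite RintegralD// Rintegral_sum// I0 (eq_bigr _ (fun j _ => Ik j)).
by rewrite -mulr_suml -mulrDl subrK.
Qed.

(** The hypothesis bounds the dilated weight from below by the weight times an exponential, hence by
    the weight times an affine function. Integrating both sides and dividing by [Z] gives
    [1 + (1 - s) * A <= s ^- p]. *)
Lemma gibbs_mean_dilation (b : 'cV[R]_p) (s A : R) (g : 'I_p -> R) :
  0 < s < 1 ->
  (forall u : 'cV[R]_p, U (b + s *: (u - b)) <=
    U u - (1 - s) * (A + \sum_j g j * (u j 0 - gibbs_mean U j 0))) ->
  s ^+ p * A <= p%:R.
Proof.
move=> /andP[s0 s1] H.
have s1' : 0 < 1 - s by rewrite subr_gt0.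
have [i1 I1] := gibbs_mass_dilation b s0.
have [i2 I2] := Rintegral_gibbs_affine (1 + (1 - s) * A) (fun j => (1 - s) * g j).
have : (1 + (1 - s) * A) * Z <= s ^- p * Z.
  rewrite -I1 -I2; apply: le_Rintegral => // t _.
  rewrite /gibbs_weight.
  apply: (@le_trans _ _ (expR (- U (cvec t)) * expR ((1 - s) *
     (A + \sum_j g j * (cvec t j 0 - gibbs_mean U j 0))))).
    rewrite ler_pM2l ?expR_gt0//; apply: le_trans (expR_ge1Dx _).
    rewrite -addrA lerD2l mulrDr lerD2l mulr_sumr.
    by apply: ler_sum => j _; rewrite [cvec t j 0]mxE mulrA.
  rewrite -expRD ler_expR.
  by have := H (cvec t); lra.
rewrite ler_pM2r// => {}H.
have sp : 0 < s ^+ p by rewrite exprn_gt0.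
(* Bernoulli's inequality turns [s ^+ p * (1 - s) * A <= 1 - s ^+ p] into the claim once [1 - s] is
   cancelled. *)
have bern : forall m, 1 - s ^+ m <= m%:R * (1 - s).
  elim=> [|m IH]; first by rewrite expr0 subrr mul0r.
  have : s ^+ m <= 1 by apply: exprn_ile1; exact: ltW.
  rewrite exprS -natr1; have := exprn_ge0 m (ltW s0); nra.
have := bern p.
have : s ^+ p * (1 + (1 - s) * A) <= 1.
  by rewrite -(ler_pM2l sp) mulfV ?gt_eqF in H.
move=> Ha Hb; rewrite -(ler_pM2r s1'); move: Ha Hb.
by move: (s ^+ p) (1 - s) => q r; nra.
Qed.

End gibbs_dilation.

(** * The exponentially weighted aggregate *)

Section potential.
Variables (R : realType) (n p : nat) (X : 'M[R]_(n, p)).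
Implicit Types (y : 'cV[R]_n) (b u m : 'cV[R]_p) (lambda tau s : R).

(** Letting both [y] and [b] vary covers integration over the parameter with fixed data as well as
    joint measurability in noise and parameter. *)
Lemma measurable_potential d (D : measurableType d) (y : D -> 'cV[R]_n)
    (b : D -> 'cV[R]_p) lambda :
  (forall i, measurable_fun setT (fun z => y z i 0)) ->
  (forall j, measurable_fun setT (fun z => b z j 0)) ->
  measurable_fun setT (fun z => potential X (y z) lambda (b z)).
Proof.
move=> my mb; apply: measurable_funD; apply: measurable_funM => //.
  apply: measurable_sum => i; apply: measurable_funX.
  apply: measurable_funB => //.
  rewrite [X in measurable_fun _ X](_ : _ = fun z => \sum_j X i j * b z j 0).
    by apply: measurable_sum => j; exact: measurable_funM.
  by apply/funext => z; rewrite mxE; apply: eq_bigr => j _; rewrite mxE.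
rewrite [X in measurable_fun _ X](_ : _ = fun z => \sum_j `|b z j 0|).
  by apply: measurable_sum => j; exact: measurableT_comp.
by apply/funext => z; apply: eq_big => j; rewrite ?inE.
Qed.

Lemma potential_ge y lambda b :
  lambda * norm1 [set: 'I_p]%SET b <= potential X y lambda b.
Proof.
rewrite lerDr mulr_ge0 ?invr_ge0 ?mulr_ge0//.
by apply: sumr_ge0 => i _; exact: sqr_ge0.
Qed.

(* [g] is a subgradient at [m] of [potential + s * pred_loss / 2]. *)
Lemma potential_dilation y lambda b m s : 0 < s < 1 -> 0 < lambda ->
  exists g : 'I_p -> R, forall u,
    potential X y lambda (b + s *: (u - b)) <=
    potential X y lambda u - (1 - s) *
      (potential X y lambda m + s * (2^-1 * pred_loss X m b)
       - potential X y lambda b + \sum_j g j * (u j 0 - m j 0)).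
Proof.
move=> /andP[s0 s1] l0.
have s1' : 0 < 1 - s by rewrite subr_gt0.
pose e i : R := y i 0 - (X *m b) i 0.
pose D v i : R := (X *m (v - b)) i 0.
pose G i : R := - 2 * (e i - D m i) + 2 * s * D m i.
(* [G i] is the derivative of [(e i - x) ^+ 2 + s * x ^+ 2] at [x = D m i], and the sign of [m j 0]
   is a subgradient of the absolute value, also at 0. *)
exists (fun j => (2 * n%:R)^-1 * (\sum_i G i * X i j) + lambda * Num.sg (m j 0)).
move=> u.
have resE v i : y i 0 - (row i X *m v) 0 0 = e i - D v i.
  by rewrite -row_mul /e /D mulmxBr !mxE; ring.
have DE i : D (b + s *: (u - b)) i = s * D u i.
  by rewrite /D addrAC subrr add0r -scalemxAr mxE.
have Db i : D b i = 0 by rewrite /D subrr mulmx0 mxE.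
have gradE : \sum_j ((2 * n%:R)^-1 * (\sum_i G i * X i j) +
      lambda * Num.sg (m j 0)) * (u j 0 - m j 0) =
    (2 * n%:R)^-1 * (\sum_i G i * (D u i - D m i)) +
    lambda * \sum_j Num.sg (m j 0) * (u j 0 - m j 0).
  under eq_bigr do rewrite mulrDl -!mulrA.
  rewrite big_split/= -!mulr_sumr; congr (_ * _ + _).
  rewrite (eq_bigr (fun j => \sum_i G i * X i j * (u j 0 - m j 0))); last first.
    by move=> j _; rewrite mulr_suml.
  rewrite exchange_big/=; apply: eq_bigr => i _.
  have -> : D u i - D m i = \sum_j X i j * (u j 0 - m j 0).
    rewrite /D !mxE -sumrB; apply: eq_bigr => j _; rewrite !mxE; ring.
  by rewrite mulr_sumr; apply: eq_bigr => j _; rewrite mulrA.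
rewrite gradE /potential /pred_loss /sqnorm2 /norm1.
have bigT (F : 'I_p -> R) : \sum_(j in [set: 'I_p]%SET) F j = \sum_j F j.
  by apply: eq_bigl => j; rewrite inE.
rewrite !bigT.
have quad : \sum_i (y i 0 - (row i X *m (b + s *: (u - b))) 0 0) ^+ 2 <=
    \sum_i (y i 0 - (row i X *m u) 0 0) ^+ 2 - (1 - s) *
    (\sum_i (y i 0 - (row i X *m m) 0 0) ^+ 2 + s * \sum_i D m i ^+ 2
     - \sum_i (y i 0 - (row i X *m b) 0 0) ^+ 2
     + \sum_i G i * (D u i - D m i)).
  rewrite !mulr_sumr -sumrN -!big_split/= mulr_sumr -sumrN -big_split/=.
  apply: ler_sum => i _; rewrite !resE DE Db /G.
  (* This is exactly the gap between the two sides: [1 - s] times the excess over its tangent at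
     [D m i] of a quadratic with leading coefficient [1 + s]. *)
  have : 0 <= (1 - s) * (1 + s) * (D u i - D m i) ^+ 2.
    by rewrite mulr_ge0 ?sqr_ge0// mulr_ge0//; lra.
  move=> H; rewrite -subr_ge0; apply: le_trans H _.
  by rewrite le_eqVlt; apply/orP; left; apply/eqP; ring.
(* For the l1 part, convexity of the absolute value handles the dilated point, and the subgradient
   inequality at [m] reduces to [Num.sg (m j 0) * u j 0 <= |u j 0|]. *)
have lone : \sum_j `|(b + s *: (u - b)) j 0| <= \sum_j `|u j 0| - (1 - s) *
    (\sum_j `|m j 0| - \sum_j `|b j 0| + \sum_j Num.sg (m j 0) * (u j 0 - m j 0)).
  rewrite -sumrN -!big_split/= mulr_sumr -sumrN -big_split/=.
  apply: ler_sum => j _; rewrite !mxE.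
  have h1 : `|b j 0 + s * (u j 0 - b j 0)| <= (1 - s) * `|b j 0| + s * `|u j 0|.
    rewrite (_ : b j 0 + _ = (1 - s) * b j 0 + s * u j 0); last by ring.
    by rewrite (le_trans (ler_normD _ _))// !normrM (gtr0_norm s0) (gtr0_norm s1').
  have h2 : Num.sg (m j 0) * u j 0 <= `|u j 0|.
    apply: le_trans (ler_norm _) _; rewrite normrM normr_sg.
    by case: (_ != 0); rewrite ?mul1r// mul0r.
  have h3 : Num.sg (m j 0) * m j 0 = `|m j 0| by rewrite normrEsg.
  apply: le_trans h1 _; rewrite mulrBr h3; nra.
have n2 : 0 <= (2 * n%:R : R)^-1 by rewrite invr_ge0 mulr_ge0.
have := ler_wpM2l n2 quad.
have := ler_wpM2l (ltW l0) lone.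
rewrite -/(D m) (_ : 2^-1 * (n%:R^-1 * _) = (2 * n%:R)^-1 * \sum_i D m i ^+ 2);
  last by rewrite invfM mulrA.
lra.
Qed.

End potential.

Section ewa_potential.
Variables (R : realType) (n p : nat) (X : 'M[R]_(n, p)) (y : 'cV[R]_n).
Variables (lambda tau : R).
Hypotheses (lambda_gt0 : 0 < lambda) (tau_gt0 : 0 < tau).
Local Notation T := (p.-tuple (measurableTypeR R)).
Local Notation leb := (power_measure (@lebesgue_measure R) p).

Let U (b : 'cV[R]_p) := potential X y lambda b / tau.

Lemma measurable_cvec j : measurable_fun setT (fun t : T => cvec t j 0).
Proof.
rewrite [X in measurable_fun _ X](_ : _ = @tnth _ _ ^~ j).
  exact: measurable_tnth.
by apply/funext => t; rewrite mxE.
Qed.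

Lemma measurable_scaled_potential : measurable_fun setT (fun t : T => U (cvec t)).
Proof.
apply: measurable_funM => //.
by apply: measurable_potential => // j; exact: measurable_cvec.
Qed.

Lemma scaled_potential_ge b : lambda / tau * norm1 [set: 'I_p]%SET b - 0 <= U b.
Proof.
rewrite subr0 /U mulrAC ler_wpM2r ?invr_ge0 ?(ltW tau_gt0)//.
exact: potential_ge.
Qed.

(** The pseudo-posterior is normalized inside the integral; integrability of the coordinates lets
    the constant out. *)
Lemma ewa_gibbs_mean : ewa X y lambda tau = gibbs_mean U.
Proof.
have c0 : 0 < lambda / tau by rewrite divr_gt0.
apply/colP => j; rewrite !mxE /gibbs_mass.
rewrite -RintegralZr//; last first.
  exact: integrable_gibbs_coord c0 measurable_scaled_potential scaled_potential_ge j.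
apply: eq_Rintegral => t _.
rewrite /pseudo_posterior !mxE mulrA /gibbs_weight /U mulNr.
congr (_ * _ / _).
by apply: eq_Rintegral => u _; rewrite mulNr.
Qed.

Lemma potential_ewa b :
  potential X y lambda (ewa X y lambda tau)
    + 2^-1 * pred_loss X (ewa X y lambda tau) b <=
  potential X y lambda b + p%:R * tau.
Proof.
have c0 : 0 < lambda / tau by rewrite divr_gt0.
set m := ewa X y lambda tau.
set a := potential X y lambda m - potential X y lambda b.
set q := 2^-1 * pred_loss X m b.
suff : a + q <= p%:R * tau by rewrite /a; lra.
(* [gibbs_mean_dilation] is applied with [A = (a + s * q) / tau]. *)
have H s : 0 < s < 1 -> s ^+ p * (a + s * q) <= p%:R * tau.
  move=> s01; have [g Hg] := potential_dilation X y b m s01 lambda_gt0.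
  rewrite -ler_pdivrMr// -mulrA.
  apply: (gibbs_mean_dilation c0 measurable_scaled_potential scaled_potential_ge
    (b := b) (g := fun j => g j / tau)) => // u.
  rewrite -ewa_gibbs_mean -/m /U.
  rewrite (eq_bigr (fun j => g j * (u j 0 - m j 0) / tau)); last first.
    by move=> j _; rewrite mulrAC.
  rewrite -mulr_suml -mulrDl mulrA -mulrBl ler_pM2r ?invr_gt0//.
  apply: le_trans (Hg u) _.
  by rewrite /a /q; lra.
(* The bound holds for every [s < 1], and its left-hand side is continuous in [s]. *)
have cvgH : (s ^+ p * (a + s * q)) @[s --> (1 : R)^'-] --> a + q.
  have -> : a + q = 1 ^+ p * (a + 1 * q) by rewrite expr1n !mul1r.
  apply: cvg_at_left_filter; apply: cvgM; first exact: exprn_continuous.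
  by apply: cvgD; [exact: cvg_cst|apply: cvgM; [exact: cvg_id|exact: cvg_cst]].
apply: (cvgr_to_le cvgH); near=> s; apply: H; apply/andP; split.
  by near: s; exact: nbhs_left_gt.
by near: s; exact: nbhs_left_lt.
Unshelve. all: by end_near. Qed.

End ewa_potential.

(** * Oracle inequality *)

Section oracle_inequality.
Variables (R : realType) (n p : nat) (X : 'M[R]_(n, p)).
Implicit Types (b u v : 'cV[R]_p) (J : {set 'I_p}).

Lemma norm1_setID J b :
  norm1 [set: 'I_p]%SET b = norm1 J b + norm1 (~: J) b.
Proof.
rewrite /norm1 (bigID (mem J))/=; congr (_ + _); apply: eq_bigl => j.
  by rewrite inE.
by rewrite !inE.
Qed.

Lemma norm1_ge0 J b : 0 <= norm1 J b.
Proof. exact: sumr_ge0. Qed.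

Lemma pred_loss_ge0 b u : 0 <= pred_loss X b u.
Proof.
by rewrite mulr_ge0 ?invr_ge0//; apply: sumr_ge0 => i _; exact: sqr_ge0.
Qed.

(** The triangle inequality is used in opposite directions: to bound [b] on [J], and [v - b] on the
    complement. *)
Lemma norm1_cone J b v :
  norm1 [set: 'I_p]%SET (v - b)
    + 2 * (norm1 [set: 'I_p]%SET b - norm1 [set: 'I_p]%SET v) <=
  3 * norm1 J (v - b) - norm1 (~: J) (v - b) + 4 * norm1 (~: J) b.
Proof.
rewrite !(norm1_setID J).
have hJ : norm1 J b <= norm1 J (v - b) + norm1 J v.
  rewrite /norm1 -big_split/=; apply: ler_sum => j _; rewrite !mxE.
  by rewrite distrC -{1}(subrK (v j 0) (b j 0)) ler_normD.
have hJc : norm1 (~: J) (v - b) <= norm1 (~: J) v + norm1 (~: J) b.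
  rewrite /norm1 -big_split/=; apply: ler_sum => j _; rewrite !mxE.
  exact: ler_normB.
by have := norm1_ge0 J v; lra.
Qed.

Lemma dual_norm1 (xi : 'cV[R]_n) (u : 'cV[R]_p) (M : R) :
  (forall j, `|\sum_i X i j * xi i 0| <= M) ->
  \sum_i xi i 0 * (X *m u) i 0 <= M * norm1 [set: 'I_p]%SET u.
Proof.
move=> H; rewrite (eq_bigr (fun i => \sum_j X i j * xi i 0 * u j 0)); last first.
  move=> i _; rewrite mxE mulr_sumr; apply: eq_bigr => j _; ring.
rewrite exchange_big/= /norm1 mulr_sumr.
rewrite [leRHS](eq_bigl predT); last by move=> j; rewrite inE.
apply: ler_sum => j _; rewrite -mulr_suml.
apply: le_trans (ler_norm _) _; rewrite normrM ler_wpM2r//.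
Qed.

Lemma potential_noise betastar (xi : 'cV[R]_n) lambda v :
  potential X (X *m betastar + xi) lambda v =
  (2 * n%:R)^-1 * (\sum_i xi i 0 ^+ 2)
  - n%:R^-1 * (\sum_i xi i 0 * (X *m (v - betastar)) i 0)
  + 2^-1 * pred_loss X v betastar + lambda * norm1 [set: 'I_p]%SET v.
Proof.
rewrite /potential /pred_loss /sqnorm2; congr (_ + _).
rewrite (eq_bigr (fun i => xi i 0 ^+ 2 +
    (- 2 * (xi i 0 * (X *m (v - betastar)) i 0) + (X *m (v - betastar)) i 0 ^+ 2))).
  rewrite !big_split/= -mulr_sumr invfM.
  by move: (n%:R^-1) => k; field.
move=> i _; rewrite -row_mul mulmxBr !mxE; ring.
Qed.

(** [r] stands for the cardinality of [J] over the compatibility factor, and the last hypothesis is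
    the compatibility condition cleared of denominators. In the difference of the potentials at [v]
    and [b], the noise costs at most [lambda / 2] times the l1-norm of [v - b], and [norm1_cone]
    does the rest. *)
Lemma oracle_inequality betastar (xi : 'cV[R]_n) (lambda t r : R)
    (v b : 'cV[R]_p) J :
  (0 < n)%N -> 0 < lambda -> 0 <= r ->
  (forall j, `|\sum_i X i j * xi i 0| <= n%:R * lambda / 2) ->
  let y := X *m betastar + xi in
  potential X y lambda v + 2^-1 * pred_loss X v b <= potential X y lambda b + t ->
  (forall u, norm1 (~: J) u < 3 * norm1 J u ->
    (3 * norm1 J u - norm1 (~: J) u) ^+ 2 <=
      9 * r * (n%:R^-1 * sqnorm2 (X *m u))) ->
  pred_loss X v betastar <= pred_loss X b betastar
    + 4 * lambda * norm1 (~: J) b + 9 * lambda ^+ 2 / 4 * r + 2 * t.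
Proof.
move=> n0 l0 r0 Hxi y; rewrite /y !potential_noise => Hv Hr.
have n0' : (0 : R) < n%:R by rewrite ltr0n.
set u := v - b.
have xiE : \sum_i xi i 0 * (X *m (v - betastar)) i 0 =
    \sum_i xi i 0 * (X *m (b - betastar)) i 0 + \sum_i xi i 0 * (X *m u) i 0.
  have -> : v - betastar = b - betastar + u by rewrite [RHS]addrC addrA subrK.
  rewrite -big_split/=; apply: eq_bigr => i _.
  by rewrite mulmxDr mxE mulrDr.
have dual : n%:R^-1 * (\sum_i xi i 0 * (X *m u) i 0) <=
    lambda / 2 * norm1 [set: 'I_p]%SET u.
  have := dual_norm1 u Hxi; rewrite -ler_pdivlMl ?invr_gt0// invrK.
  by rewrite !mulrA.
have cone := norm1_cone J b v.
have L0 := pred_loss_ge0 v b.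
(* The term [pred_loss X v b] gained from strong convexity pays for the cone term. *)
suff : lambda * (3 * norm1 J u - norm1 (~: J) u) <=
    pred_loss X v b + 9 * lambda ^+ 2 / 4 * r.
  have := ler_wpM2l (ltW l0) cone; rewrite -/u.
  move: Hv; rewrite xiE [n%:R^-1 * (_ + _)]mulrDr; lra.
have rl0 : 0 <= 9 * lambda ^+ 2 / 4 * r by rewrite !mulr_ge0// ltW.
(* Outside the cone the left-hand side is nonpositive; inside, both sides are nonnegative and can be
   squared. *)
case: (ltP (norm1 (~: J) u) (3 * norm1 J u)) => [uJ|uJ]; last first.
  apply: (@le_trans _ _ 0); last exact: addr_ge0.
  by rewrite pmulr_rle0// subr_le0.
have := Hr _ uJ; rewrite -/(pred_loss X v b) => Hsq.
rewrite -ler_sqr ?nnegrE ?addr_ge0//; last first.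
  by rewrite mulr_ge0 ?(ltW l0)// subr_ge0 ltW.
have := ler_wpM2l (sqr_ge0 lambda) Hsq; rewrite -exprMn => /le_trans; apply.
rewrite -subr_ge0.
(* This is [(x + y)^2 - 4xy = (x - y)^2]; it accounts for the constant 9/4. *)
have -> : (pred_loss X v b + 9 * lambda ^+ 2 / 4 * r) ^+ 2 -
  lambda ^+ 2 * (9 * r * pred_loss X v b) =
  (pred_loss X v b - 9 * lambda ^+ 2 / 4 * r) ^+ 2 by field.
exact: sqr_ge0.
Qed.

End oracle_inequality.

(** * Measurability of the aggregate in the noise *)

Section measurable_ewa.
Variables (R : realType) (n p : nat) (X : 'M[R]_(n, p)).
Context d (D : measurableType d).
Local Notation T := (p.-tuple (measurableTypeR R)).
Local Notation leb := (power_measure (@lebesgue_measure R) p).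

(** Tonelli is applied to the positive and negative parts separately. *)
Lemma measurable_Rintegral_section (f : D * T -> R) : measurable_fun setT f ->
  measurable_fun setT (fun x => \int[leb]_t f (x, t)).
Proof.
move=> mf; have mEf : measurable_fun setT (EFin \o f) by exact/measurable_EFinP.
apply: (@measurableT_comp _ _ _ _ _ _ fine) => //.
rewrite [X in measurable_fun _ X](_ : _ = fun x =>
    (\int[leb]_t (EFin \o f)^\+ (x, t) - \int[leb]_t (EFin \o f)^\- (x, t))%E).
  apply: emeasurable_funB; apply: measurable_power_measure_section => //.
    exact: measurable_funepos.
  exact: measurable_funeneg.
by apply/funext => x; rewrite /= integralE; congr (_ - _)%E;
  apply: eq_integral => t _; rewrite ?funeposE ?funenegE.
Qed.

Lemma measurable_pred_loss (m : D -> 'cV[R]_p) b :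
  (forall j, measurable_fun setT (fun z => m z j 0)) ->
  measurable_fun setT (fun z => pred_loss X (m z) b).
Proof.
move=> mm; apply: measurable_funM => //; apply: measurable_sum => i.
apply: measurable_funX.
rewrite [X in measurable_fun _ X](_ : _ =
    fun z => \sum_j X i j * (m z j 0 - b j 0)).
  apply: measurable_sum => j; apply: measurable_funM => //.
  exact: measurable_funB.
by apply/funext => z; rewrite mxE; apply: eq_bigr => j _; rewrite !mxE.
Qed.

Lemma measurable_ewa (y : D -> 'cV[R]_n) (lambda tau : R) j :
  0 < lambda -> 0 < tau ->
  (forall i, measurable_fun setT (fun z => y z i 0)) ->
  measurable_fun setT (fun z => ewa X (y z) lambda tau j 0).
Proof.
move=> l0 t0 my.
have c0 : 0 < lambda / tau by rewrite divr_gt0.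
pose w (z : D * T) := expR (- (potential X (y z.1) lambda (cvec z.2) / tau)).
have mcv j' : measurable_fun setT (fun z : D * T => cvec z.2 j' 0).
  exact: (measurableT_comp (@measurable_cvec R p j')).
have mw : measurable_fun setT w.
  apply: measurableT_comp => //; apply: measurableT_comp => //.
  apply: measurable_funM => //; apply: measurable_potential => // i.
  exact: (measurableT_comp (my i)).
have mtw : measurable_fun setT (fun z : D * T => tnth z.2 j * w z).
  apply: measurable_funM => //.
  exact: (measurableT_comp (measurable_tnth j)).
pose Z z := \int[leb]_t w (z, t).
have Z0 z : 0 < Z z.
  exact: (gibbs_mass_gt0 c0 (measurable_scaled_potential X (y z) lambda tau)
    (scaled_potential_ge X (y z) lambda t0)).
(* The inverse is written [exp (- ln _)] to get its measurability. *)
rewrite [X in measurable_fun _ X](_ : _ =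
    fun z => (\int[leb]_t (tnth t j * w (z, t))) * expR (- ln (Z z))).
  apply: measurable_funM.
    exact: (measurable_Rintegral_section mtw).
  apply: measurableT_comp => //; apply: measurableT_comp => //.
  apply: measurableT_comp => //; exact: measurable_Rintegral_section.
by apply/funext => z; rewrite ewa_gibbs_mean// mxE expRN lnK// posrE.
Qed.

End measurable_ewa.

(** * The compatibility factor in the extended reals *)

Section compatibility_cone.
Variables (R : realType) (n p : nat) (X : 'M[R]_(n, p)) (J : {set 'I_p}).
Hypothesis n_gt0 : (0 < n)%N.

Lemma compatibility_ge0 c : (0 <= compatibility X J c)%E.
Proof.
apply: le_ereal_inf_tmp => _ [u _ <-]; rewrite lee_fin divr_ge0//.
  apply: mulr_ge0; first by rewrite mulr_ge0// sqr_ge0.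
  by apply: sumr_ge0 => i _; exact: sqr_ge0.
by rewrite mulr_ge0 ?sqr_ge0.
Qed.

Lemma compatibility_set0 c : J = finset.set0 -> compatibility X J c = +oo%E.
Proof.
move=> J0; rewrite /compatibility (_ : [set u | _] = set0).
  by rewrite image_set0 ereal_inf0.
apply/seteqP; split => u //=; rewrite J0 {2}/norm1 big_set0 mulr0.
by rewrite ltNge norm1_ge0.
Qed.

(* If [compatibility X J 3 = 0] then [J] is not empty and the right-hand side is
   [+oo]; if it is [+oo] then no [u] is in the cone and [r = 0] is admissible. *)
Lemma compatibility_cone (a : R) (t : \bar R) : 0 < a ->
  (forall r : R, 0 <= r ->
    (forall u, norm1 (~: J) u < 3 * norm1 J u ->
      (3 * norm1 J u - norm1 (~: J) u) ^+ 2 <=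
        9 * r * (n%:R^-1 * sqnorm2 (X *m u))) -> (t <= (a * r)%:E)%E) ->
  (t <= a%:E * (#|J|%:R%:E / compatibility X J 3))%E.
Proof.
move=> a0 H.
have lb u : norm1 (~: J) u < 3 * norm1 J u ->
    (compatibility X J 3 <= (3 ^+ 2 * #|J|%:R * sqnorm2 (X *m u)
                  / (n%:R * (3 * norm1 J u - norm1 (~: J) u) ^+ 2))%:E)%E.
  by move=> uJ; apply: ereal_inf_lbound; exists u.
have := compatibility_ge0 3.
case k : (compatibility X J 3) => [k'| |] // k0; rewrite k in lb.
- rewrite lee_fin le_eqVlt in k0; case/predU1P : k0 => [k0|k0].
    rewrite -k0 inve0.
    have [J0|/set0Pn[j jJ]] := eqVneq J finset.set0.
      by move: k; rewrite compatibility_set0.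
    have J0 : (0 < #|J|)%N by apply/card_gt0P; exists j.
    by rewrite gt0_muley ?lte_fin ?ltr0n// gt0_muley ?lte_fin// leey.
  (* For a positive finite factor [k'], the witness is [r = #|J| / k']. *)
  rewrite inver gt_eqF// -!EFinM; apply: H => [|u uJ].
    by rewrite divr_ge0// ltW.
  have s0 : 0 < 3 * norm1 J u - norm1 (~: J) u by rewrite subr_gt0.
  have n0 : (0 : R) < n%:R by rewrite ltr0n.
  have := lb u uJ; rewrite lee_fin ler_pdivlMr; last first.
    by rewrite mulr_gt0// exprn_gt0.
  rewrite mulrA -ler_pdivlMl ?mulr_gt0// => /le_trans; apply.
  by rewrite le_eqVlt; apply/orP; left; apply/eqP; field;
     rewrite ?gt_eqF.
- rewrite invey mule0 mule0 -[0%E]/(0%:E) -(mulr0 a); apply: H => // u uJ.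
  by have := lb u uJ.
Qed.

End compatibility_cone.

(** * Probability of the noise event *)

Section noise_event.
Context d (Omega : measurableType d) (R : realType) (P : probability Omega R).

Lemma union_bound p (B : 'I_p -> set Omega) (q : R) :
  (forall j, measurable (B j)) -> (forall j, (P (B j) <= (q / p%:R)%:E)%E) ->
  (0 < p)%N -> exists2 E, measurable E /\ ((1 - q)%:E <= P E)%E &
    forall omega, E omega -> forall j, ~ B j omega.
Proof.
move=> mB PB p0.
(* The family is extended by the empty set to all natural numbers, since subadditivity is applied to
   a sequence. *)
pose F k := if insub k is Some j then B j else set0.
have FE (j : 'I_p) : F j = B j by rewrite /F valK.
have mF k : measurable (F k) by rewrite /F; case: insub.
pose U := \big[setU/set0]_(k < p) F k.
have mU : measurable U by exact: bigsetU_measurable.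
have PU : (P U <= q%:E)%E.
  have /le_trans := @content_subadditive _ _ _ P U F p (fun k _ => mF k) mU
    (@subset_refl _ U); apply.
  apply: (@le_trans _ _ (\sum_(j < p) (q / p%:R)%:E)%E).
    by apply: lee_sum => j _; rewrite FE; exact: PB.
  rewrite sumEFin sumr_const card_ord -[X in X%:E]mulr_natr divfK// pnatr_eq0.
  by rewrite -lt0n.
exists (~` U); first split.
- exact: measurableC.
- by rewrite probability_setC// EFinB leeB.
- move=> omega nU j Bj; apply: nU.
  by rewrite /U -bigcup_mkord; exists j => //=; rewrite FE.
Qed.

(** Each column has squared norm at most [n], so at level [u = n * lambda / 2] the tail bound is
    [exp (- n lambda^2 / (8 sigma^2))]. The lower bound on [lambda] makes it at most [delta / p],
    ready for the union bound. *)
Lemma noise_event n p (X : 'M[R]_(n, p)) (sigma delta lambda : R)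
    (xi : {RV P >-> n.-tuple R}) :
  (0 < n)%N -> (0 < p)%N ->
  (forall j : 'I_p, n%:R^-1 * sqnorm2 (col j X) <= 1) ->
  0 < sigma -> 0 < delta -> delta < 1 -> 0 < lambda ->
  (forall A : set (n.-tuple R), measurable A ->
     distribution P xi A = isotropic_gaussian sigma A) ->
  2 * sigma * Num.sqrt (2 / n%:R * ln (p%:R / delta)) <= lambda ->
  exists2 E, measurable E /\ ((1 - delta)%:E <= P E)%E &
    forall omega, E omega ->
      forall j, `|\sum_i X i j * cvec (xi omega) i 0| <= n%:R * lambda / 2.
Proof.
move=> n_gt0 p_gt0 Xn s0 d0 d1 l0 xiG lge.
have n0 : (0 : R) < n%:R by rewrite ltr0n.
have p0 : (0 : R) < p%:R by rewrite ltr0n.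
pose u := n%:R * lambda / 2.
have u0 : 0 < u by rewrite divr_gt0// mulr_gt0.
pose B j := [set t : n.-tuple R | u < `|\sum_i X i j * tnth t i|].
have mB j : measurable (B j) by exact: measurable_abs_linear_form_gt.
have [||E [mE PE] HE] := @union_bound p (fun j => xi @^-1` B j) delta _ _ p_gt0.
- by move=> j; rewrite -[X in measurable X]setTI; exact: measurable_funPT.
- move=> j; have := xiG _ (mB j); rewrite /distribution /pushforward => ->.
  have Xj : \sum_i X i j ^+ 2 <= n%:R.
    have := Xn j; rewrite ler_pdivrMl// mulr1; apply: le_trans.
    by rewrite /sqnorm2; under [leRHS]eq_bigr do rewrite mxE.
  apply: le_trans (isotropic_gaussian_tail s0 u0 n0 Xj) _.
  rewrite lee_fin -[leRHS]lnK ?posrE ?divr_gt0// ler_expR.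
  rewrite -[delta / _]invf_div lnV ?posrE ?divr_gt0// mulNr lerN2.
  set L := ln _ in lge *.
  (* As [delta < 1 <= p], the logarithm is nonnegative and the square root really squares back to
     its argument. *)
  have L0 : 0 <= L.
    rewrite ln_ge0// ler_pdivlMr// mul1r (le_trans (ltW d1))//.
    by rewrite ler1n.
  rewrite ler_pdivlMr; last by rewrite !mulr_gt0// exprn_gt0.
  have a0 : 0 <= 2 / n%:R * L by rewrite mulr_ge0// divr_ge0// ltW.
  have : (2 * sigma * Num.sqrt (2 / n%:R * L)) ^+ 2 <= lambda ^+ 2.
    by rewrite ler_sqr ?nnegrE ?mulr_ge0 ?sqrtr_ge0// ltW.
  rewrite exprMn sqr_sqrtr// => H.
  have := ler_wpM2l (sqr_ge0 (n%:R / 2)) H; rewrite -exprMn.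
  rewrite /u (_ : n%:R / 2 * lambda = n%:R * lambda / 2); last by ring.
  apply: le_trans.
  by rewrite le_eqVlt; apply/orP; left; apply/eqP; field; rewrite gt_eqF.
- exists E => // omega Eo j; have := HE omega Eo j; rewrite /B/= => /negP.
  rewrite -leNgt /u.
  rewrite [X in _ -> `|X| <= _](eq_bigr (fun i => X i j * tnth (xi omega) i))//.
  by move=> i _; rewrite [cvec _ _ _]mxE.
Qed.

End noise_event.

Theorem theorem1 (R : realType) (n p : nat) (n_gt0 : (0 < n)%N)
    (p_gt0 : (0 < p)%N) (X : 'M[R]_(n, p))
    (X_normalized : forall j : 'I_p, n%:R^-1 * sqnorm2 (col j X) <= 1)
    (betastar : 'cV[R]_p) (sigma : R) (sigma_gt0 : 0 < sigma)
    (d : measure_display) (Omega : measurableType d) (P : probability Omega R)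
    (xi : {RV P >-> n.-tuple R})
    (xi_gaussian : forall A : set (n.-tuple R), measurable A ->
       distribution P xi A = isotropic_gaussian sigma A)
    (tau : R) (tau_gt0 : 0 < tau)
    (delta : R) (delta_gt0 : 0 < delta) (delta_lt1 : delta < 1)
    (lambda : R) (lambda_gt0 : 0 < lambda)
    (lambda_ge : 2 * sigma * Num.sqrt (2 / n%:R * ln (p%:R / delta)) <= lambda) :
  ((1 - delta)%:E <= P [set omega |
     let y := (X *m betastar + cvec (xi omega))%R in
     (pred_loss X (ewa X y lambda tau) betastar)%:E <=
     ereal_inf [set ((pred_loss X bJ.1 betastar
                      + 4 * lambda * norm1 (~: bJ.2) bJ.1)%:E
                     + (9 * lambda ^+ 2 / 4)%:E
                       * (#|bJ.2|%:R%:E / compatibility X bJ.2 3))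
               | bJ in [set: 'cV[R]_p * {set 'I_p}]]
     + (2 * p%:R * tau)%:E])%E.
Proof.
have [E [mE PE] HE] := noise_event n_gt0 p_gt0 X_normalized sigma_gt0 delta_gt0
  delta_lt1 lambda_gt0 xi_gaussian lambda_ge.
apply: (le_trans PE); apply: le_measure; rewrite ?inE//.
  (* The right-hand side is the same for all [omega], so the event is a sublevel set of the
     prediction loss. *)
  rewrite -[X in measurable X]setTI; apply: emeasurable_fun_infty_c => //.
  apply/measurable_EFinP; apply: measurable_pred_loss => j.
  apply: measurable_ewa => // i.
  rewrite [X in measurable_fun _ X](_ : _ =
      fun omega => (X *m betastar) i 0 + tnth (xi omega) i).
    apply: measurable_funD => //.
    apply: (measurableT_comp (measurable_tnth i)).
    exact: measurable_funPT.
  by apply/funext => omega; rewrite mxE [cvec _ _ _]mxE.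
move=> omega Eo /=.
(* The finite terms are moved to the left, leaving on the right only the compatibility term, which
   may be infinite. *)
rewrite -leeBlDr//; apply: le_ereal_inf_tmp => _ [[b J] _ <-] /=.
rewrite -leeBlDl//; apply: compatibility_cone => // [|r r0 Hr].
  by rewrite divr_gt0// mulr_gt0// exprn_gt0.
rewrite -!EFinB lee_fin.
have := oracle_inequality n_gt0 lambda_gt0 r0 (HE _ Eo)
  (potential_ewa X (X *m betastar + cvec (xi omega)) lambda_gt0 tau_gt0 b) Hr.
lra.
Qed.
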